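(* Let $G=X$ be a compact group equipped with a left- and right-invariant metric $d$, acting on itself by left multiplication. Let $\delta>0$ and an integer $n\ge 1$ be given, and let $\mu$ be a probability distribution on $X$ defined by a density function (with respect to Haar measure). If $e:X^n\to G$ is any ($n$-sample) estimator, then there exists a shift-invariant ($n$-sample) estimator $s:X^n\to G$ with $Q(s)\ge Q(e)$.
   Context: $G=X$ is a compact topological group, and $d$ is a metric inducing its topology with $d(gx,gy)=d(x,y)=d(xg,yg)$ for all $x,y,g\in G$. For $\theta\in G$, the shifted distribution $\mu_\theta$ on $X$ is $\mu_\theta(A)=\mu(\{x:\theta x\in A\})$, and $\mu_\theta^n$ is the product measure $\mu_\theta\times\cdots\times\mu_\theta$ on $X^n$. An ($n$-sample) estimator is a (Borel) measurable function $e:X^n\to G$. Its $\delta$-quality is $Q(e)=\inf_{\theta\in G}Q^\theta(e)$, where $Q^\theta(e)=\mu_\theta^n(\{\mathbf{x}\in X^n: d(e(\mathbf{x}),\theta)<\delta\})$. The estimator $e$ is shift-invariant if $e(gx_1,\ldots,gx_n)=g\,e(x_1,\ldots,x_n)$ for all $g\in G$ and $(x_1,\ldots,x_n)\in X^n$. *)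

(* Defs.v *)
From HB Require Import structures.
From mathcomp Require Import all_boot all_order all_algebra.
From mathcomp Require Import all_classical all_reals all_analysis.

Set Implicit Arguments.
Unset Strict Implicit.
Unset Printing Implicit Defensive.

Local Open Scope classical_set_scope.
Local Open Scope ring_scope.

HB.mixin Record isTopologicalGroup G of Group G & Topological G := {
  mulg_continuous : continuous (fun p : G * G => (p.1 * p.2)%g) ;
  invg_continuous : continuous (fun x : G => x^-1%g)
}.

(* A topological group whose topology is the one induced by the distance
   [mdist]. The base point is unconstrained and plays no role: it is present
   because the measurable types of the library are pointed. *)
#[short(type="metricGroupType")]
HB.structure Definition MetricGroup (R : numDomainType) :=
  {G of Pointed G & Group G & Metric R G & isTopologicalGroup G}.

Definition bi_invariant (R : numDomainType) (G : metricGroupType R) : Prop :=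
  forall g x y : G,
    mdist (g * x)%g (g * y)%g = mdist x y /\
    mdist (x * g)%g (y * g)%g = mdist x y.

Notation borel T := (g_sigma_algebraType (@open T)).

Section statistics.
Local Open Scope ereal_scope.
Context {R : realType} {G : metricGroupType R}.

(* On a compact group Haar measure is normalized to total mass 1. *)
Definition is_haar (h : probability (borel G) R) : Prop :=
  forall (g : G) (A : set (borel G)), measurable A ->
    h [set x : G | A (g * x)%g] = h A.

Definition has_haar_density (mu : probability (borel G) R) : Prop :=
  exists (h : probability (borel G) R) (f : borel G -> R),
    [/\ is_haar h, (forall x, 0 <= f x)%R, measurable_fun setT f
      & forall A, measurable A -> mu A = \int[h]_(x in A) (f x)%:E].

Definition shifted (mu : set (borel G) -> \bar R) (theta : G) :
    set (borel G) -> \bar R :=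
  fun A => mu [set x : G | A (theta * x)%g].

(* The [n]-fold product m \x (m \x ( ... )), transported from nested pairs to
   tuples. *)
Fixpoint power_measure (m : set (borel G) -> \bar R) (n : nat) :
    set (n.-tuple (borel G)) -> \bar R :=
  match n with
  | 0%N => dirac [tuple]
  | k.+1 =>
      pushforward (m \x @power_measure m k)
        (fun p : borel G * k.-tuple (borel G) => [tuple of p.1 :: p.2])
  end.

(* [n.-tuple G] with the product topology, carried over from the function space
   ['I_n -> G] along the bijection [tnth]. The library's own sigma-algebra on
   tuples, on which [power_measure] lives, is the product of the Borel
   sigma-algebras; for compact [G], hence second countable, it coincides with
   the Borel sigma-algebra of this topology. *)
Definition sample_space (n : nat) : ptopologicalType :=
  initial_topology
    (fun x : n.-tuple G => tnth x : prod_topology (fun _ : 'I_n => G)).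

Definition estimator (n : nat) (e : n.-tuple G -> G) : Prop :=
  measurable_fun [set: borel (sample_space n)]
    (e : borel (sample_space n) -> borel G).

Definition shift_invariant (n : nat) (e : n.-tuple G -> G) : Prop :=
  forall (g : G) (x : n.-tuple G),
    e [tuple (g * tnth x i)%g | i < n] = (g * e x)%g.

Definition quality_at (mu : set (borel G) -> \bar R) (delta : R) (n : nat)
    (e : n.-tuple G -> G) (theta : G) : \bar R :=
  power_measure (shifted mu theta) [set x | (mdist (e x) theta < delta)%R].

Definition quality (mu : set (borel G) -> \bar R) (delta : R) (n : nat)
    (e : n.-tuple G -> G) : \bar R :=
  ereal_inf (range (quality_at mu delta e)).

End statistics.

(* Main.v *)
Require Import Defs.
From HB Require Import structures.
From mathcomp Require Import all_boot all_order all_algebra.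
From mathcomp Require Import all_classical all_reals all_analysis.
From mathcomp Require Import measurable_realfun.
From mathcomp Require Import lebesgue_integral_nonneg lebesgue_integral_fubini.

Set Implicit Arguments.
Unset Strict Implicit.
Unset Printing Implicit Defensive.

Import Order.TTheory GRing.Theory Num.Theory.

Local Open Scope classical_set_scope.
Local Open Scope ring_scope.

(** Every shift-invariant estimator is determined by its values on the
    transversal of the samples whose first coordinate is a fixed point, and the
    given estimator [e], restricted to such a transversal, yields one.  For
    [g] in [G] the transversal of first coordinate [g^-1] gives

      [s_g x = x_1 * g * e ((x_1 * g)^-1 . x)],

    where the dot is the diagonal left translation; [s_g] is shift-invariant
    because [x_1 * g] is equivariant in [x] and [(x_1 * g)^-1 . x] is
    invariant.  The claim is that some [g] gives [quality s_g >= quality e],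
    and this is a pigeonhole argument on the Haar average over [g].

    By left invariance of the distance the quality of [s_g] at [theta] does not
    depend on [theta]: it is the [mu^n]-measure [q g] of the samples [x] such
    that [(x_1 * g, x)] belongs to

      [E = {(a, x) | d (a * e (a^-1 . x), 1) < delta}].

    For a fixed [x], the left invariance of the Haar measure removes [x_1], so
    that by Tonelli ([haar_translate]) the average of [q] is that of
    [g |-> mu^n {x | (g, x) \in E}].  Moving [g] to the other side of the
    distance, the latter is the quality of [e] at [g^-1], which is at least
    [quality e].  Hence the average of [q] is at least [quality e], and so is
    one of its values ([exists_ge_integral]).

    The remaining work is measurability: multiplication has to be measurable
    for the product of the Borel sigma-algebras ([measurable_mulg]) and the
    Borel sets of the product topology have to be measurable for the
    sigma-algebra that carries the product measure ([open_tuple_measurable]).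
    Both come from the second countability of a compact metric space. *)

(** * Borel sets of finite powers of the group *)

(** The basic sets are grouped by their codes in [nat], a number that codes
    nothing giving the empty set: this makes a total sequence of open sets even
    of a finite or an empty basis. *)
Lemma second_countable_sequence (T : topologicalType) :
  second_countable (T := T) ->
  exists b : nat -> set T, (forall k, open (b k)) /\
    forall x V, nbhs x V -> exists k, b k x /\ b k `<=` V.
Proof.
move=> [B /pcard_leP/unsquash f [Bop Bnbhs]].
exists (fun k => \bigcup_(U in [set U | B U /\ f U = k]) U); split=> [k|x V].
  by apply: bigcup_open => U [/Bop].
move=> /Bnbhs [U [BU Ux] UV]; exists (f U); split; first by exists U.
move=> y [W [BW fWU] Wy]; apply: UV.
by rewrite /= -(_ : W = U)//; apply: (@inj _ _ _ f); rewrite ?inE.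
Qed.

Lemma measurable_fun_open d (T : measurableType d) (X : ptopologicalType)
    (f : T -> borel X) :
  (forall A : set X, open A -> measurable (f @^-1` A)) -> measurable_fun setT f.
Proof.
move=> fA.
apply: (@measurability _ _ T (borel X) setT f (@open X)) => // _ [A Aop <-].
by rewrite setTI; exact: fA.
Qed.

Section borel_power.
Context {R : realType} {G : metricGroupType R}.

Lemma tnth_continuous n (i : 'I_n) :
  continuous (fun x : sample_space (G:=G) n => tnth x i : G).
Proof.
move=> x.
apply: (@continuous_comp (sample_space (G:=G) n) (prod_topology (fun=> G)) G
   (fun x => tnth x) (fun f => f i)).
  exact: initial_continuous.
exact: (@proj_continuous _ (fun=> G) i).
Qed.

Lemma sample_box n (x : n.-tuple G) (U : set (sample_space (G:=G) n)) :
  nbhs (x : sample_space n) U ->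
  exists A : 'I_n -> set G, (forall i, nbhs (tnth x i) (A i)) /\
    [set y | forall i, A i (tnth y i)] `<=` U.
Proof.
move=> [_ [[C Cop <-] Cx] CU].
(* The boxes around x generate a filter; it converges to x, because it does so
   coordinatewise. *)
pose F : set_system (prod_topology (fun _ : 'I_n => G)) := fun W =>
  exists A : 'I_n -> set G, (forall i, nbhs (tnth x i) (A i)) /\
    [set f | forall i, A i (f i)] `<=` W.
have FF : Filter F.
  split.
  - by exists (fun=> setT); split=> // i; exact: filterT.
  - move=> P Q [A [Ax AP]] [B [Bx BQ]]; exists (fun i => A i `&` B i).
    split=> [i|f fAB]; first exact: filterI.
    by split; [apply: AP|apply: BQ] => i; case: (fAB i).
  - by move=> P Q PQ [A [Ax AP]]; exists A; split=> // f /AP/PQ.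
have Fx : F --> (tnth x : prod_topology _).
  apply/cvg_sup => i W.
  have /= -> := @nbhsE (initial_topology (proj i)) (tnth x).
  move=> [_ [[D Dop <-] Dx] DW]; apply: filterS DW _.
  exists (fun j => if j == i then D else setT); split=> [j|f /(_ i)].
    case: eqP => [->|_]; last exact: filterT.
    exact: open_nbhs_nbhs.
  by rewrite /= eqxx.
have [A [Ax AC]] : F C by apply: Fx; exact: open_nbhs_nbhs.
by exists A; split=> // y Ay; apply/CU/AC.
Qed.

(** Samples carry two sigma-algebras: estimators are measurable for the Borel
    sets of the product topology, while the product measure lives on the
    product sigma-algebra.  This lemma and [measurable_tuple_of_sample]
    let measurability pass from one to the other. *)
Lemma measurable_sample_of_tuple d (T : measurableType d) n
    (f : n.-tuple (borel G) -> T) :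
 measurable_fun [set: n.-tuple (borel G)] f ->
 measurable_fun [set: borel (sample_space (G:=G) n)] f.
Proof.
move=> mf.
apply: (@measurableT_comp _ _ _ (borel (sample_space n))
  (n.-tuple (borel G)) _ f setT id) => //.
apply/measurable_fun_tnthP => i.
apply: (measurable_fun_open (X:=G)) => A Aop.
apply: sub_sigma_algebra.
by move/continuousP: (@tnth_continuous n i); exact.
Qed.

Hypothesis compact_G : compact [set: G].

(** An open set is the union of the boxes it contains whose sides are basic open
    sets, and there are countably many of those, indexed by tuples of natural
    numbers. *)
Lemma open_tuple_measurable n (U : set (sample_space (G:=G) n)) :
  open U -> measurable (U : set (n.-tuple (borel G))).
Proof.
move=> Uop.
have [b [bop bnbhs]] :=
  second_countable_sequence (compact_second_countable compact_G).
pose box (t : n.-tuple nat) : set (n.-tuple (borel G)) :=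
  [set y | forall i, b (tnth t i) (tnth y i)].
pose F t := if `[< box t `<=` U >] then box t else set0.
have -> : U = \bigcup_t F t.
  apply/seteqP; split=> [x Ux|x [t _]]; last first.
    by rewrite /F; case: asboolP => // tU /tU.
  have [A [Ax AU]] := sample_box (open_nbhs_nbhs (conj Uop Ux)).
  have /choice [k kP] i : exists k, b k (tnth x i) /\ b k `<=` A i.
    exact: bnbhs.
  exists [tuple k i | i < n] => //; rewrite /F.
  have bU : box [tuple k i | i < n] `<=` U.
    move=> y yb; apply: AU => i /=; apply: (kP i).2.
    by have := yb i; rewrite tnth_mktuple.
  case: asboolP => // _ i; rewrite tnth_mktuple; exact: (kP i).1.
apply: countable_bigcupT_measurable => // t; rewrite /F.
case: ifP => // _.
have -> : box t = \bigcap_(i in [set: 'I_n]) [set y | b (tnth t i) (tnth y i)].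
  by apply/seteqP; split=> y yb i => [_|]; exact: yb.
apply: fin_bigcap_measurable => // i _.
rewrite -[X in measurable X]setTI; apply: measurable_tnth => //.
exact: sub_sigma_algebra.
Qed.

Lemma measurable_tuple_of_sample d (T : measurableType d) n
    (f : n.-tuple (borel G) -> T) :
 measurable_fun [set: borel (sample_space (G:=G) n)] f ->
 measurable_fun [set: n.-tuple (borel G)] f.
Proof.
move=> mf.
apply: (@measurableT_comp _ _ _ (n.-tuple (borel G))
  (borel (sample_space n)) _ f setT id) => //.
apply: (measurable_fun_open (X:=sample_space n)) => A Aop.
exact: open_tuple_measurable.
Qed.

Lemma measurable_continuous_sample d (T : measurableType d) n
    (u : T -> n.-tuple (borel G)) (f : sample_space (G:=G) n -> G) :
  continuous f -> measurable_fun setT u ->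
  measurable_fun setT (fun t => f (u t) : borel G).
Proof.
move=> /continuousP fc mu; apply: (measurable_fun_open (X:=G)) => A Aop.
rewrite -[_ @^-1` _]/(u @^-1` (f @^-1` A)).
rewrite -[X in measurable X]setTI; apply: mu => //.
by apply: open_tuple_measurable; exact: fc.
Qed.

(** Continuity of the product only gives measurability for the Borel sets of
    [G * G]; the product is seen here as a continuous function on the samples of
    size 2, so that these sets become measurable for the product
    sigma-algebra. *)
Lemma measurable_mulg d (T : measurableType d) (u v : T -> borel G) :
  measurable_fun setT u -> measurable_fun setT v ->
  measurable_fun setT (fun t => (u t * v t)%g : borel G).
Proof.
move=> mu mv.
pose mul2 (x : sample_space (G:=G) 2) : G := (tnth x ord0 * tnth x ord_max)%g.
apply: (measurable_continuous_sample (f:=mul2) (u:=fun t => [tuple u t; v t])).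
  move=> x; apply: (@continuous2_cvg (sample_space (G:=G) 2) G G G (nbhs x) _
    (fun y => tnth y ord0) (fun y => tnth y ord_max) (fun a b => (a * b)%g) _ _
    (mulg_continuous (_, _)) (@tnth_continuous _ _ x) (@tnth_continuous _ _ x)).
by apply: measurable_cons => //; apply: measurable_cons.
Qed.

Lemma measurable_invg :
  measurable_fun setT (fun x : borel G => (x^-1)%g : borel G).
Proof.
apply: (measurable_fun_open (X:=G)) => A Aop.
apply: sub_sigma_algebra.
by move/continuousP: (@invg_continuous R G); exact.
Qed.

End borel_power.

(** * Averages and sections *)

Section averages.
Local Open Scope ereal_scope.

Lemma integral_xsection_ysection d1 d2 (T1 : measurableType d1)
    (T2 : measurableType d2) (R : realType)
    (m1 : {sigma_finite_measure set T1 -> \bar R})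
    (m2 : {sigma_finite_measure set T2 -> \bar R}) (A : set (T1 * T2)) :
  measurable A ->
  \int[m1]_x m2 (xsection A x) = \int[m2]_y m1 (ysection A y).
Proof.
move=> mA; have := indic_fubini_tonelli m1 m2 mA.
by rewrite indic_fubini_tonelli_FE// indic_fubini_tonelli_GE.
Qed.

Lemma section_measureE d1 d2 (T1 : measurableType d1) (T2 : measurableType d2)
    (R : realType) (P : probability T2 R) (A : set (T1 * T2)) :
  (fun x => P [set y | A (x, y)]) = P \o xsection A.
Proof.
apply/funext => x; congr (P _); apply/funext => y.
by rewrite /xsection/= in_setE.
Qed.

(** Otherwise [c - f] is positive everywhere, while its integral is at most 0:
    it vanishes almost everywhere, but the whole space is not negligible. *)
Lemma exists_ge_integral d (T : measurableType d) (R : realType)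
    (P : probability T R) (f : T -> \bar R) (c : R) :
  measurable_fun setT f -> (forall x, 0 <= f x) ->
  c%:E <= \int[P]_x f x -> exists x, c%:E <= f x.
Proof.
move=> mf f0 cf; apply/not_existsP => fc.
have {}fc x : f x < c%:E by rewrite ltNge; apply/negP.
have mcf : measurable_fun setT (fun x => c%:E - f x).
  by apply: emeasurable_funB.
have cf0 x : 0 <= c%:E - f x by apply: ltW; rewrite sube_gt0.
have ic : \int[P]_x f x + \int[P]_x (c%:E - f x) = c%:E.
  rewrite -ge0_integralD//.
  transitivity (\int[P]_x c%:E).
    apply: eq_integral => x _; rewrite addeC subeK//.
    by rewrite ge0_fin_numE// (lt_trans (fc x))// ltry.
  by rewrite integral_cst//= probability_setT mule1.
have finf : \int[P]_x f x \is a fin_num.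
  rewrite ge0_fin_numE ?integral_ge0// (@le_lt_trans _ _ c%:E) ?ltry//.
  by rewrite -ic leeDl// integral_ge0.
have i0 : \int[P]_x (c%:E - f x) = 0.
  apply/eqP; rewrite eq_le integral_ge0// andbT leNgt.
  by rewrite -(lteDl _ finf) ic -leNgt.
have /(ae_eq_integral_abs P measurableT mcf) :
    \int[P]_x `|c%:E - f x| = 0.
  by rewrite -[RHS]i0; apply: eq_integral => x _; rewrite gee0_abs.
move=> [N [mN PN0 subN]].
have : P setT <= P N.
  apply: le_measure; rewrite ?inE// => x _; apply: subN => /= /(_ I) /eqP.
  by rewrite sube_eq// ?add0e; apply/negP; rewrite gt_eqF.
by rewrite probability_setT PN0 leNgt lte01.
Qed.

End averages.

(** * Product measures *)

Section power_measures.
Local Open Scope ereal_scope.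
Context {R : realType} {G : metricGroupType R}.

(** [power_measure] is a bare set function; this gives it back the structure of
    a measure, on which the theory of integration relies. *)
Lemma power_measure_probability (m : probability (borel G) R) n :
  exists P : probability (n.-tuple (borel G)) R,
    P = power_measure m (n:=n) :> (set _ -> _).
Proof.
elim: n => [|n [P PE]] /=; first by exists (dirac [tuple]).
pose cons_tuple (p : borel G * n.-tuple (borel G)) := [tuple of p.1 :: p.2].
have mcons : measurable_fun setT cons_tuple by exact: measurable_cons.
pose X : {mfun (borel G * n.-tuple (borel G))%type >-> n.+1.-tuple (borel G)} :=
  HB.pack cons_tuple (isMeasurableFun.Build _ _ _ _ _ mcons).
by exists (distribution (m \x P) X); rewrite -PE.
Qed.

(** The diagonal map commutes with the construction of the product measure:
    each section of the preimage is the preimage of a section. *)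
Lemma power_measure_pushforward (m : probability (borel G) R)
    (f : {mfun borel G >-> borel G}) n (A : set (n.-tuple (borel G))) :
  measurable A ->
  power_measure (pushforward m f) A = power_measure m (map_tuple f @^-1` A).
Proof.
elim: n A => [|n IHn] A mA /=.
  by congr dirac; apply/funext => x; congr (A _); apply: eq_from_tnth => -[].
have [P PE] := power_measure_probability (distribution m f) n.
pose cons_tuple (p : borel G * n.-tuple (borel G)) := [tuple of p.1 :: p.2].
have mcons : measurable_fun setT cons_tuple by exact: measurable_cons.
have mA' : measurable (cons_tuple @^-1` A).
  by rewrite -[X in measurable X]setTI; exact: mcons.
rewrite /pushforward /product_measure1 -/(pushforward m f) -PE.
rewrite ge0_integral_pushforward//=.
apply: eq_integral => x _ /=.
rewrite PE IHn//; last exact: (measurable_xsection _ mA').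
  congr (power_measure _ _); apply/funext => y; rewrite /preimage /xsection/=.
  by rewrite !in_setE /=; congr (A _); apply: val_inj.
exact: (measurable_fun_xsection P mA').
Qed.

End power_measures.

(** * Diagonal translations of samples *)

Section translations.
Local Open Scope ereal_scope.
Context {R : realType} {G : metricGroupType R}.

Definition lshift (g : G) n (x : n.-tuple G) : n.-tuple G :=
  [tuple (g * tnth x i)%g | i < n].

Lemma lshiftM (g h : G) n (x : n.-tuple G) :
  lshift (g * h)%g x = lshift g (lshift h x).
Proof. by apply: eq_from_tnth => i; rewrite !tnth_mktuple mulgA. Qed.

Lemma lshift1 n (x : n.-tuple G) : lshift 1%g x = x.
Proof. by apply: eq_from_tnth => i; rewrite !tnth_mktuple mul1g. Qed.

Lemma measurable_mdist_lt (delta : R) (theta : G) :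
  measurable ([set a | (mdist a theta < delta)%R] : set (borel G)).
Proof.
apply: sub_sigma_algebra; rewrite /= openE => a /= a_near.
apply/nbhs_ballP; exists (delta - mdist a theta)%R.
  by rewrite /= subr_gt0.
rewrite ballEmdist => b /=; rewrite ltrBrDr metric_sym.
by apply: le_lt_trans; exact: metric_triangle.
Qed.

Lemma measurable_estimate_lt (delta : R) n (e : n.-tuple G -> G) (theta : G) :
  measurable_fun [set: n.-tuple (borel G)] (e : _ -> borel G) ->
  measurable
    ([set x | (mdist (e x) theta < delta)%R] : set (n.-tuple (borel G))).
Proof.
move=> me; have := me measurableT _ (measurable_mdist_lt delta theta).
by rewrite setTI.
Qed.

Hypothesis compact_G : compact [set: G].

Lemma measurable_lshift d (T : measurableType d) n (u : T -> borel G)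
    (v : T -> n.-tuple (borel G)) :
  measurable_fun setT u -> measurable_fun setT v ->
  measurable_fun setT (fun t => lshift (u t) (v t) : n.-tuple (borel G)).
Proof.
move=> mu mv; apply/measurable_fun_tnthP => i.
rewrite (_ : _ \o _ = fun t => (u t * tnth (v t) i)%g); last first.
  by apply/funext => t /=; rewrite tnth_mktuple.
apply: (measurable_mulg compact_G) => //.
exact: (measurableT_comp (measurable_tnth i) mv).
Qed.

Lemma power_measure_shifted (m : probability (borel G) R) (theta : G) n
    (A : set (n.-tuple (borel G))) : measurable A ->
  power_measure (shifted m theta) A =
  power_measure m (lshift theta (n:=n) @^-1` A).
Proof.
move=> mA.
have mtheta : measurable_fun setT (fun x : borel G => (theta * x)%g : borel G).
  exact: (measurable_mulg compact_G).
pose f : {mfun borel G >-> borel G} :=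
  HB.pack (fun x : G => (theta * x)%g) (isMeasurableFun.Build _ _ _ _ _ mtheta).
rewrite -[shifted m theta]/(pushforward m f) power_measure_pushforward//.
congr (power_measure _ _); apply/funext => x; congr (A _).
by apply: eq_from_tnth => i; rewrite tnth_map tnth_mktuple.
Qed.

Lemma quality_atE (m : probability (borel G) R) (delta : R) n
    (e : n.-tuple G -> G) (theta : G) :
  measurable_fun [set: n.-tuple (borel G)] (e : _ -> borel G) ->
  quality_at m delta e theta =
  power_measure m [set x | (mdist (e (lshift theta x)) theta < delta)%R].
Proof.
move=> me; rewrite /quality_at power_measure_shifted//.
exact: measurable_estimate_lt.
Qed.

Lemma measurable_translate d (T : measurableType d) (u : T -> borel G)
    (E : set (borel G * T)) :
  measurable_fun setT u -> measurable E ->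
  measurable [set p : borel G * T | E ((u p.2 * p.1)%g, p.2)].
Proof.
move=> mu mE.
have mshear : measurable_fun setT
    (fun p : borel G * T => ((u p.2 * p.1)%g : borel G, p.2)).
  apply: measurable_fun_pair => //.
  by apply: (measurable_mulg compact_G) => //; exact: measurableT_comp.
by rewrite -[X in measurable X]setTI; exact: mshear.
Qed.

(** By Tonelli the integral over [g] may be taken first, at a fixed [x], where
    [u x] is a constant that left invariance absorbs. *)
Lemma haar_translate (h : probability (borel G) R) d (T : measurableType d)
   (P : probability T R) (u : T -> borel G) (E : set (borel G * T)) :
  is_haar h -> measurable_fun setT u -> measurable E ->
  \int[h]_g P [set x | E ((u x * g)%g, x)] = \int[h]_g P [set x | E (g, x)].
Proof.
move=> hh mu mE; have mF := measurable_translate mu mE.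
have /= -> := section_measureE P E.
have /= -> := section_measureE (T1 := borel G) P
  [set p | E ((u p.2 * p.1)%g, p.2)].
rewrite !integral_xsection_ysection//; apply: eq_integral => x _.
transitivity (h [set g : G | ysection E x (u x * g)%g]); last first.
  by apply: hh; exact: measurable_ysection.
by congr (h _); apply/funext => g; rewrite /ysection/= !in_setE.
Qed.

End translations.

(** * Averaging over transversals *)

Theorem theorem9 (R : realType) (G : metricGroupType R)
    (compact_G : compact [set: G]) (d_invariant : bi_invariant G)
    (delta : R) (delta_gt0 : 0 < delta) (n : nat) (n_ge1 : (1 <= n)%N)
    (mu : probability (borel G) R) (mu_density : has_haar_density mu)
    (e : n.-tuple G -> G) (est_e : estimator e) :
  exists s : n.-tuple G -> G,
    [/\ estimator s, shift_invariant s
      & (quality mu delta e <= quality mu delta s)%E].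
Proof.
case: n n_ge1 e est_e => // n _ e est_e.
have [h [_ [haar_h _ _ _]]] := mu_density.
have me := measurable_tuple_of_sample compact_G est_e.
have dl g x y : mdist (g * x)%g (g * y)%g = mdist x y := (d_invariant g x y).1.
have [P PE] := power_measure_probability mu n.+1.
pose H (p : borel G * n.+1.-tuple (borel G)) : borel G :=
  (p.1 * e (lshift p.1^-1 p.2))%g.
have mH : measurable_fun setT H.
  apply: (measurable_mulg compact_G) => //.
  apply: (measurableT_comp me).
  apply: (measurable_lshift compact_G) => //.
  by apply: measurableT_comp => //; exact: measurable_invg.
pose s g (x : n.+1.-tuple G) : G := H ((thead x * g)%g, x).
have ms g : measurable_fun [set: n.+1.-tuple (borel G)] (s g : _ -> borel G).
  apply: (measurableT_comp mH); apply: measurable_fun_pair => //.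
  apply: (measurable_mulg compact_G) => //; exact: measurable_tnth.
have sinv g : shift_invariant (s g).
  move=> a x; rewrite -/(lshift a x) /s /H /= /thead tnth_mktuple -!mulgA.
  by rewrite invgM -lshiftM -mulgA mulVg mulg1.
pose E := H @^-1` [set a | mdist a 1%g < delta].
have mE : measurable E.
  have := mH measurableT _ (measurable_mdist_lt delta 1%g).
  by rewrite setTI.
pose q (g : borel G) := P [set x | E ((thead x * g)%g, x)].
have qE g theta : quality_at mu delta (s g) theta = q g.
  rewrite quality_atE// -PE; congr (P _); apply/funext => x /=.
  by rewrite sinv -{2}[theta]mulg1 dl.
have qual_e g : quality_at mu delta e g^-1%g = P [set x | E (g, x)].
  rewrite quality_atE// -PE; congr (P _); apply/funext => x /=.
  by rewrite /H/= -(dl g) mulgV.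
have quality_ge0 : (0 <= quality mu delta e)%E.
  by apply: le_ereal_inf_tmp => _ [theta _ <-]; rewrite quality_atE// -PE.
have quality_fin : quality mu delta e \is a fin_num.
  rewrite ge0_fin_numE//.
  apply: (@le_lt_trans _ _ (quality_at mu delta e 1%g)).
    by apply: ereal_inf_lbound; exists 1%g.
  rewrite quality_atE// -PE.
  under eq_set do rewrite lshift1.
  rewrite (le_lt_trans _ (ltry 1))// probability_le1//.
  exact: measurable_estimate_lt.
have q_ge : (quality mu delta e <= \int[h]_g q g)%E.
  rewrite (haar_translate compact_G P haar_h _ mE); last exact: measurable_tnth.
  rewrite -[leLHS]mule1 -(probability_setT h) -integral_cst//.
  have mPE : measurable_fun setT (fun g => P [set x | E (g, x)]).
    by have /= -> := section_measureE P E; exact: measurable_fun_xsection.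
  apply: ge0_le_integral => // g _.
  by rewrite -qual_e; apply: ereal_inf_lbound; exists g^-1%g.
have mq : measurable_fun setT q.
  rewrite /q; have /= -> := section_measureE (T1 := borel G) P
    [set p | E ((thead p.2 * p.1)%g, p.2)].
  exact: (measurable_fun_xsection P
    (measurable_translate compact_G (measurable_tnth ord0) mE)).
have [g g_ge] : exists g, (quality mu delta e <= q g)%E.
  rewrite -(fineK quality_fin) in q_ge *.
  by apply: (exists_ge_integral mq) q_ge => g; rewrite /q.
exists (s g); split=> //; first exact: measurable_sample_of_tuple.
by apply: le_ereal_inf_tmp => _ [theta _ <-]; rewrite qE.
Qed.
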